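(* In the Kerr spacetime with $m=1$, $0\le a\le1$, put $r_+=1+(1-a^2)^{1/2}$ and $\epsilon=a/r$. For $8/3>r>r_+$, if $\epsilon\ll1$ (that is, $\epsilon$ is sufficiently small), then any solution $x,y$ on $[0,\pi]$ of the system $$\begin{cases} y_\theta=-\dfrac{(\Sigma^2H)_r}{2HR^2}x+\left(\dfrac{\Sigma_\theta}{\Sigma}-\dfrac{H_\theta}{2H}\right)y,\\[2mm] x_\theta=\dfrac{R_\theta}{R}x+\left(\dfrac{(\Sigma^2H)_r}{2H\Sigma^2}-\dfrac{\alpha\beta+xyH_\theta}{2H\ell}\right)y,\end{cases}$$ with $|x_\theta|,|y_\theta|$ bounded must be the trivial solution $x\equiv0$, $y\equiv0$.
   Context: Here $r$ is fixed, $x,y$ are functions of $\theta$, and, for the Kerr metric in Boyer-Lindquist coordinates with mass $m=1$ and angular momentum per unit mass $a$, $\Sigma^2=r^2+a^2\cos^2\theta$, $\Delta=r^2-2r+a^2$, $R^2=\Sigma^2/\Delta$, $H=\dfrac{\sin^2\theta\left((r^2+a^2)^2-\Delta a^2\sin^2\theta\right)}{\Sigma^2}$ (with $R,\Sigma>0$), and $r_+$ is the larger root of $\Delta=0$. Furthermore $\alpha=(x^2\Sigma^2+R^2(y^2+\Sigma^2))^{1/2}$, $\beta=(-H_\theta^2+4H(y^2+\Sigma^2))^{1/2}$, $\ell=y^2+\Sigma^2$; subscripts $r,\theta$ denote partial derivatives. Some coefficients of the system are singular at $\theta=0,\pi$. *)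

(* Defs.v *)
From Stdlib Require Import Reals.
From Coquelicot Require Import Coquelicot.
Open Scope R_scope.

(** Kerr metric in Boyer-Lindquist coordinates, mass m = 1, angular momentum
    per unit mass a. Geometric quantities are functions of (a, r, theta). *)

Definition Delta (a r : R) : R := r ^ 2 - 2 * r + a ^ 2.

Definition r_plus (a : R) : R := 1 + sqrt (1 - a ^ 2).

Definition Sigma (a r th : R) : R := sqrt (r ^ 2 + a ^ 2 * cos th ^ 2).

(** The function called R in the mathematics, with R^2 = Sigma^2 / Delta. *)
Definition Rfun (a r th : R) : R := sqrt (Sigma a r th ^ 2 / Delta a r).

Definition H (a r th : R) : R :=
  sin th ^ 2 * ((r ^ 2 + a ^ 2) ^ 2 - Delta a r * a ^ 2 * sin th ^ 2)
  / Sigma a r th ^ 2.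

Definition Sigma2H (a r th : R) : R := Sigma a r th ^ 2 * H a r th.

Definition d_r (f : R -> R -> R -> R) (a r th : R) : R :=
  Derive (fun s => f a s th) r.

Definition d_theta (f : R -> R -> R -> R) (a r th : R) : R :=
  Derive (fun t => f a r t) th.

(** In the four definitions below, x and y stand for the values x(theta) and
    y(theta) of the unknown functions. *)

Definition ell (a r th y : R) : R := y ^ 2 + Sigma a r th ^ 2.

Definition alpha (a r th x y : R) : R :=
  sqrt (x ^ 2 * Sigma a r th ^ 2
        + Rfun a r th ^ 2 * (y ^ 2 + Sigma a r th ^ 2)).

(** The radicand is nonnegative when a / r is small: it is then at least
    4 H Sigma^2 - H_theta^2 >= 0. *)
Definition beta (a r th y : R) : R :=
  sqrt (- d_theta H a r th ^ 2
        + 4 * H a r th * (y ^ 2 + Sigma a r th ^ 2)).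

Definition y_rhs (a r th x y : R) : R :=
  - (d_r Sigma2H a r th / (2 * H a r th * Rfun a r th ^ 2)) * x
  + (d_theta Sigma a r th / Sigma a r th
     - d_theta H a r th / (2 * H a r th)) * y.

Definition x_rhs (a r th x y : R) : R :=
  d_theta Rfun a r th / Rfun a r th * x
  + (d_r Sigma2H a r th / (2 * H a r th * Sigma a r th ^ 2)
     - (alpha a r th x y * beta a r th y + x * y * d_theta H a r th)
       / (2 * H a r th * ell a r th y)) * y.

(** The coefficients are singular at 0 and pi, so on [0, pi] a solution is
    continuous up to the end points and satisfies the equations inside. *)
Definition is_solution (a r : R) (x y : R -> R) : Prop :=
  continuous_on (fun th => 0 <= th <= PI) x /\
  continuous_on (fun th => 0 <= th <= PI) y /\
  forall th, 0 < th < PI ->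
    is_derive y th (y_rhs a r th (x th) (y th)) /\
    is_derive x th (x_rhs a r th (x th) (y th)).

Definition bounded_derivative (f : R -> R) : Prop :=
  exists M : R, forall th, 0 < th < PI -> Rabs (Derive f th) <= M.

(* Main.v *)
(** Write p = H_theta / (2H), s = Sigma_theta / Sigma = R_theta / R,
    A = (Sigma^2 H)_r / (2 H Sigma^2), k = A Delta, g = p y^2 / ell and
    c = alpha beta / (2 H ell) - A.  The system becomes
      y' = - k x + (s - p) y,    x' = s x - c y - g x.
    For a = 0 and r < 8/3 one has c > 0 and the sign of (w x y)' suffices, but
    for a > 0 and r within O(a^2) of 8/3 the coefficient c may be negative.
    Adding a Hardy-type term, f = (sqrt H / Sigma^2) y (K x + cot(theta) y)
    satisfies f' + g f <= 0 as soon as 0 < k < K and K c > -1, and both hold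
    uniformly in r with K = 3/2.  Boundedness of y' bounds cot(theta) y, so
    f = O(sin theta); with the integrating factor exp(int g), f is monotone and
    vanishes at both ends, hence is zero, and then so are x and y. *)

Require Import Defs.
From Stdlib Require Import Reals Lra.
From Coquelicot Require Import Coquelicot.
Open Scope R_scope.

(** * Bounds, closure and monotonicity on the open interval (0, pi) *)

(** Mean value theorem based at pi/2. The extra summand M in the constant lets the same B dominate
    the derivative as well. *)
Lemma bounded_of_bounded_derivative (f df : R -> R) :
  (forall t, 0 < t < PI -> is_derive f t (df t)) ->
  bounded_derivative f ->
  exists B, (forall t, 0 < t < PI -> Rabs (f t) <= B)
    /\ forall t, 0 < t < PI -> Rabs (df t) <= B.
Proof.
  intros Hd [M HM].
  pose proof PI_RGT_0 as Hpi.
  assert (HM' : forall t, 0 < t < PI -> Rabs (df t) <= M).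
  { intros t Ht. rewrite <- (is_derive_unique _ _ _ (Hd t Ht)). now apply HM. }
  assert (M0 : 0 <= M).
  { eapply Rle_trans; [apply Rabs_pos | apply (HM' (PI / 2)); lra]. }
  exists (Rabs (f (PI / 2)) + M * PI + M).
  pose proof (Rabs_pos (f (PI / 2))).
  split; intros t Ht; [| specialize (HM' t Ht); nra].
  destruct (MVT_gen f (PI / 2) t df) as [z [Hz E]].
  - intros z Hz; apply Hd; revert Hz.
    unfold Rmin, Rmax; destruct Rle_dec; lra.
  - intros z Hz. apply derivable_continuous_pt. exists (df z).
    apply is_derive_Reals, Hd. revert Hz.
    unfold Rmin, Rmax; destruct Rle_dec; lra.
  - assert (Hz' : 0 < z < PI).
    { revert Hz. unfold Rmin, Rmax; destruct Rle_dec; lra. }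
    replace (f t) with (f (PI / 2) + df z * (t - PI / 2)) by lra.
    eapply Rle_trans; [apply Rabs_triang |].
    rewrite Rabs_mult.
    assert (Rabs (t - PI / 2) <= PI) by (apply Rabs_le; lra).
    assert (Rabs (df z) * Rabs (t - PI / 2) <= M * PI).
    { apply Rmult_le_compat; auto using Rabs_pos. }
    lra.
Qed.

Lemma continuous_on_zero_closure (f : R -> R) :
  continuous_on (fun t => 0 <= t <= PI) f ->
  (forall t, 0 < t < PI -> f t = 0) ->
  forall t, 0 <= t <= PI -> f t = 0.
Proof.
  intros Hc Hz t Ht.
  pose proof PI_RGT_0 as Hpi.
  destruct (Req_dec (f t) 0) as [E | E]; [exact E | exfalso].
  assert (Hp : 0 < Rabs (f t)) by now apply Rabs_pos_lt.
  destruct (proj1 (filterlim_locally f (f t)) (Hc t Ht) (mkposreal _ Hp))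
    as [[d Hd0] Hd]; simpl in Hd.
  (* A shift by h towards pi/2 stays within distance d of t and lands strictly inside (0, pi), even
     from an end point. *)
  set (h := Rmin (d / 2) (PI / 4)).
  assert (Hh : 0 < h <= d / 2 /\ h <= PI / 4).
  { unfold h; repeat split; [apply Rmin_pos; lra | apply Rmin_l | apply Rmin_r]. }
  assert (Hs : exists s, 0 < s < PI /\ Rabs (s - t) < d).
  { destruct (Rle_lt_dec t (PI / 2)).
    - exists (t + h). split; [lra |]. apply Rabs_def1; lra.
    - exists (t - h). split; [lra |]. apply Rabs_def1; lra. }
  destruct Hs as [s [Hs1 Hs2]].
  assert (HB : Rabs (f s - f t) < Rabs (f t)).
  { apply (Hd s); [exact Hs2 | lra]. }
  rewrite (Hz s Hs1) in HB.
  replace (0 - f t) with (- f t) in HB by ring.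
  rewrite Rabs_Ropp in HB. lra.
Qed.

(** A nonincreasing function that tends to 0 at both ends is squeezed to 0, so its derivative
    vanishes too. *)
Lemma decreasing_vanishing_at_ends (G dG : R -> R) (C : R) :
  (forall t, 0 < t < PI -> is_derive G t (dG t)) ->
  (forall t, 0 < t < PI -> dG t <= 0) ->
  (forall t, 0 < t < PI -> Rabs (G t) <= C * sin t) ->
  forall t, 0 < t < PI -> dG t = 0.
Proof.
  intros Hd Hneg Hb.
  pose proof PI_RGT_0 as Hpi.
  assert (Hdec : forall s t, 0 < s -> s < t -> t < PI -> G t <= G s).
  { intros s t Hs Hst Ht.
    destruct (MVT_gen G s t dG) as [z [Hz E]].
    - intros z Hz; apply Hd; revert Hz.
      unfold Rmin, Rmax; destruct Rle_dec; lra.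
    - intros z Hz. apply derivable_continuous_pt. exists (dG z).
      apply is_derive_Reals, Hd. revert Hz.
      unfold Rmin, Rmax; destruct Rle_dec; lra.
    - assert (Hz' : 0 < z < PI).
      { revert Hz. unfold Rmin, Rmax; destruct Rle_dec; lra. }
      specialize (Hneg z Hz'). nra. }
  assert (C0 : 0 <= C).
  { pose proof (Hb (PI / 2) ltac:(lra)) as HH. rewrite sin_PI2 in HH.
    pose proof (Rabs_pos (G (PI / 2))). lra. }
  assert (sle : forall s, 0 < s -> sin s <= s).
  { intros s Hs. left. now apply sin_lt_x. }
  assert (Hz : forall t, 0 < t < PI -> G t = 0).
  { intros t Ht. apply Rle_antisym; apply le_epsilon; intros e He.
    (* Here G t <= G s <= C sin s <= C s <= e; dividing by C + 1 covers C = 0. The other half is the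
       mirror image at pi - s. *)
    - set (s := Rmin (t / 2) (e / (C + 1))).
      assert (0 < e / (C + 1)) by (apply Rdiv_lt_0_compat; lra).
      assert (0 < s <= t / 2 /\ s <= e / (C + 1)) as [[s0 s1] s2].
      { unfold s; repeat split; [apply Rmin_pos; lra | apply Rmin_l | apply Rmin_r]. }
      assert (E : e / (C + 1) * (C + 1) = e) by (field; lra).
      pose proof (Hdec s t s0 ltac:(lra) ltac:(lra)).
      pose proof (Rle_trans _ _ _ (Rle_abs _) (Hb s ltac:(lra))).
      pose proof (sle s s0). nra.
    - set (s := Rmin ((PI - t) / 2) (e / (C + 1))).
      assert (0 < e / (C + 1)) by (apply Rdiv_lt_0_compat; lra).
      assert (0 < s <= (PI - t) / 2 /\ s <= e / (C + 1)) as [[s0 s1] s2].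
      { unfold s; repeat split; [apply Rmin_pos; lra | apply Rmin_l | apply Rmin_r]. }
      assert (E : e / (C + 1) * (C + 1) = e) by (field; lra).
      pose proof (Hdec t (PI - s) ltac:(lra) ltac:(lra) ltac:(lra)).
      pose proof (Hb (PI - s) ltac:(lra)) as HB.
      rewrite <- Rabs_Ropp in HB.
      pose proof (Rle_trans _ _ _ (Rle_abs _) HB).
      rewrite sin_PI_x in *.
      pose proof (sle s s0). nra. }
  intros t Ht.
  rewrite <- (is_derive_unique _ _ _ (Hd t Ht)).
  rewrite <- (Derive_const 0 t). apply Derive_ext_loc.
  apply (locally_interval _ t 0 PI); simpl; try lra.
  intros z Hz1 Hz2. apply Hz. simpl in *; lra.
Qed.

(** * Rigidity from a differential inequality *)

(* The sign condition on g makes the integrating factor exp(int_{PI/2}^t g) at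
   most 1, so no integrability of g up to the end points is needed. *)
Lemma differential_inequality_rigid (f df g : R -> R) (C : R) :
  (forall t, 0 < t < PI -> is_derive f t (df t)) ->
  (forall t, 0 < t < PI -> continuous g t) ->
  (forall t, 0 < t < PI -> 0 <= g t * cos t) ->
  (forall t, 0 < t < PI -> df t + g t * f t <= 0) ->
  (forall t, 0 < t < PI -> Rabs (f t) <= C * sin t) ->
  forall t, 0 < t < PI -> df t + g t * f t = 0.
Proof.
  intros Hd Hg Hs Hn Hb.
  pose proof PI_RGT_0 as Hpi.
  set (I := fun t => RInt g (PI / 2) t).
  assert (Hint : forall u v, 0 < u < PI -> 0 < v < PI -> ex_RInt g u v).
  { intros u v Hu Hv. apply (ex_RInt_continuous (V := R_CompleteNormedModule)).
    intros z Hz; apply Hg; revert Hz.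
    unfold Rmin, Rmax; destruct Rle_dec; lra. }
  assert (HI : forall t, 0 < t < PI -> is_derive I t (g t)).
  { intros t Ht. apply (is_derive_RInt g I (PI / 2) t); [| now apply Hg].
    apply (locally_interval _ t 0 PI); simpl; try lra.
    intros z Hz1 Hz2. apply (RInt_correct (V := R_CompleteNormedModule)), Hint;
    simpl in *; lra. }
  assert (I0 : forall t, 0 < t < PI -> I t <= 0).
  { intros t Ht. unfold I. destruct (Rle_lt_dec t (PI / 2)).
    - rewrite <- opp_RInt_swap by (apply Hint; lra).
      change (- RInt g t (PI / 2) <= 0).
      enough (0 <= RInt g t (PI / 2)) by lra.
      apply RInt_ge_0; [lra | apply Hint; lra |].
      intros z Hz. specialize (Hs z ltac:(lra)).
      pose proof (cos_gt_0 z ltac:(lra) ltac:(lra)). nra.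
    - assert (E : RInt (fun _ => 0) (PI / 2) t = 0).
      { rewrite RInt_const. unfold scal; simpl; unfold mult; simpl; ring. }
      rewrite <- E. apply RInt_le; [lra | apply Hint; lra | apply ex_RInt_const |].
      intros z Hz. specialize (Hs z ltac:(lra)).
      pose proof (cos_lt_0 z ltac:(lra) ltac:(lra)). nra. }
  assert (H0 : forall t, 0 < t < PI -> exp (I t) * (df t + g t * f t) = 0).
  { apply (decreasing_vanishing_at_ends (fun t => exp (I t) * f t) _ C).
    - intros t Ht.
      evar_last.
      { apply (is_derive_mult (fun t => exp (I t)) f t).
        - apply (is_derive_comp exp I t); [apply is_derive_exp | now apply HI].
        - now apply Hd.
        - intros; apply Rmult_comm. }
      unfold plus, mult, scal; simpl; unfold mult; simpl. ring.
    - intros t Ht. specialize (Hn t Ht). pose proof (exp_pos (I t)). nra.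
    - intros t Ht. rewrite Rabs_mult, (Rabs_pos_eq (exp _)) by (left; apply exp_pos).
      assert (exp (I t) <= 1).
      { rewrite <- exp_0. destruct (I0 t Ht) as [h | h];
        [left; now apply exp_increasing | rewrite h; lra]. }
      specialize (Hb t Ht). pose proof (Rabs_pos (f t)).
      pose proof (exp_pos (I t)). nra. }
  intros t Ht. specialize (H0 t Ht). pose proof (exp_pos (I t)).
  apply Rmult_integral in H0. lra.
Qed.

(* [f = rho y (K x + cot y)] satisfies [f' + g f = - rho Q] where
   [Q = (K - k) k x^2 + (k x + cot y)^2 + (1 + K c + (p - g) cot) y^2]. *)
Lemma lyapunov_rigid (x y rho k c g p s : R -> R) (K C : R) :
  (forall t, 0 < t < PI -> is_derive rho t ((p t - 2 * s t) * rho t)) ->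
  (forall t, 0 < t < PI -> is_derive y t (- k t * x t + (s t - p t) * y t)) ->
  (forall t, 0 < t < PI ->
     is_derive x t (s t * x t - c t * y t - g t * x t)) ->
  (forall t, 0 < t < PI -> continuous g t) ->
  (forall t, 0 < t < PI -> 0 <= g t * cos t) ->
  (forall t, 0 < t < PI -> 0 <= (p t - g t) * cos t) ->
  (forall t, 0 < t < PI -> 0 < k t < K) ->
  (forall t, 0 < t < PI -> 0 < 1 + K * c t) ->
  (forall t, 0 < t < PI -> 0 < rho t) ->
  (forall t, 0 < t < PI ->
     Rabs (rho t * (y t * (K * x t + cos t / sin t * y t))) <= C * sin t) ->
  forall t, 0 < t < PI -> x t = 0 /\ y t = 0.
Proof.
  intros Hrho Hy Hx Hg Hgc Hpg Hk Hc Hpos Hb.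
  set (f := fun t => rho t * (y t * (K * x t + cos t / sin t * y t))).
  set (Q := fun t => (K - k t) * k t * x t ^ 2
     + (k t * x t + cos t / sin t * y t) ^ 2
     + (1 + K * c t + (p t - g t) * (cos t / sin t)) * y t ^ 2).
  assert (Hcoef : forall t, 0 < t < PI ->
    0 < 1 + K * c t + (p t - g t) * (cos t / sin t)).
  { intros t Ht. specialize (Hc t Ht). specialize (Hpg t Ht).
    pose proof (sin_gt_0 t ltac:(lra) ltac:(lra)) as Hs.
    replace ((p t - g t) * (cos t / sin t))
      with ((p t - g t) * cos t * / sin t) by (unfold Rdiv; ring).
    pose proof (Rinv_0_lt_compat _ Hs). nra. }
  assert (HQ : forall t, 0 < t < PI -> 0 <= Q t).
  { intros t Ht. unfold Q. specialize (Hcoef t Ht). specialize (Hk t Ht).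
    pose proof (pow2_ge_0 (x t)). pose proof (pow2_ge_0 (y t)).
    pose proof (pow2_ge_0 (k t * x t + cos t / sin t * y t)).
    assert (0 < (K - k t) * k t) by nra. nra. }
  (* With the derivative written as -rho Q - g f, the required inequality reduces to -rho Q <= 0. *)
  assert (H0 := differential_inequality_rigid f
    (fun t => - rho t * Q t - g t * f t) g C).
  intros t Ht.
  assert (E : - rho t * Q t - g t * f t + g t * f t = 0).
  { apply H0; auto.
    - clear t Ht. intros t Ht.
      pose proof (sin_gt_0 t ltac:(lra) ltac:(lra)) as Hs.
      specialize (Hrho t Ht). specialize (Hy t Ht). specialize (Hx t Ht).
      pose proof (is_derive_unique _ _ _ Hrho : Derive (fun z => rho z) t = _) as Drho.
      pose proof (is_derive_unique _ _ _ Hy : Derive (fun z => y z) t = _) as Dy.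
      pose proof (is_derive_unique _ _ _ Hx : Derive (fun z => x z) t = _) as Dx.
      unfold f. evar_last.
      { auto_derive.
        - repeat split; try lra; eexists; eassumption.
        - rewrite Drho, Dy, Dx. reflexivity. }
      unfold Q.
      (* The 1 in [Q] comes from cot' = -(1 + cot^2); it is put over sin^2 to match the computed
         derivative. *)
      assert (E : 1 = (cos t ^ 2 + sin t ^ 2) * (1 / sin t ^ 2) - (cos t / sin t) ^ 2)
        by (field; lra).
      pose proof (sin2_cos2 t) as T. unfold Rsqr in T.
      replace (1 + K * c t + (p t - g t) * (cos t / sin t))
        with (K * c t + (p t - g t) * (cos t / sin t)
          + ((cos t ^ 2 + sin t ^ 2) * (1 / sin t ^ 2) - (cos t / sin t) ^ 2))
        by lra.
      field; lra.
    - clear t Ht. intros t Ht. specialize (HQ t Ht). specialize (Hpos t Ht). nra. }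
  (* All three summands of [Q] are nonnegative, so each vanishes; the coefficients of x^2 and y^2
     are strictly positive. *)
  assert (Q t = 0) as HQ0.
  { specialize (Hpos t Ht). nra. }
  unfold Q in HQ0.
  specialize (Hcoef t Ht). specialize (Hk t Ht).
  pose proof (pow2_ge_0 (x t)). pose proof (pow2_ge_0 (y t)).
  pose proof (pow2_ge_0 (k t * x t + cos t / sin t * y t)).
  assert (Hkk : 0 < (K - k t) * k t) by nra.
  set (q := 1 + K * c t + (p t - g t) * (cos t / sin t)) in *.
  set (m := (K - k t) * k t) in *.
  assert (0 <= m * x t ^ 2) by nra.
  assert (0 <= q * y t ^ 2) by nra.
  assert (Ex : m * x t ^ 2 = 0) by lra.
  assert (Ey : q * y t ^ 2 = 0) by lra.
  split; apply Rsqr_0_uniq; unfold Rsqr; nra.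
Qed.

(** * Closed forms of the metric coefficients *)

(** Sigma^2 without the square root, so that [field] and [auto_derive] can work with it. *)
Definition S2 (a r t : R) : R := r ^ 2 + a ^ 2 * cos t ^ 2.

(* [H = sin^2 * Hred] and [H_theta / (2 H) = cot * (1 + eta * sin^2)]. *)
Definition Hred (a r t : R) : R := r ^ 2 + a ^ 2 + 2 * a ^ 2 * r * sin t ^ 2 / S2 a r t.

Definition eta (a r t : R) : R :=
  2 * a ^ 2 * r * (r ^ 2 + a ^ 2) / (Hred a r t * S2 a r t ^ 2).

Lemma S2_pos (a r t : R) : 0 < r -> 0 < S2 a r t.
Proof.
  intros Hr. unfold S2. pose proof (pow2_ge_0 (cos t)). pose proof (pow2_ge_0 a).
  assert (0 < r ^ 2) by now apply pow_lt. nra.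
Qed.

Lemma Hred_pos (a r t : R) : 0 < r -> 0 < Hred a r t.
Proof.
  intros Hr. unfold Hred.
  assert (0 <= 2 * a ^ 2 * r * sin t ^ 2 / S2 a r t).
  { apply Rdiv_le_0_compat; [| now apply S2_pos].
    pose proof (pow2_ge_0 (sin t)). pose proof (pow2_ge_0 a).
    apply Rmult_le_pos; [nra | assumption]. }
  pose proof (pow2_ge_0 a). assert (0 < r ^ 2) by now apply pow_lt. lra.
Qed.

Lemma cos2_sin2 (t : R) : cos t ^ 2 = 1 - sin t ^ 2.
Proof. pose proof (sin2_cos2 t) as T. unfold Rsqr in T. lra. Qed.

Lemma Sigma_sqr (a r t : R) : Sigma a r t ^ 2 = S2 a r t.
Proof.
  unfold Sigma, S2. apply pow2_sqrt.
  pose proof (pow2_ge_0 r). pose proof (pow2_ge_0 (cos t)). pose proof (pow2_ge_0 a). nra.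
Qed.

Lemma Sigma_pos (a r t : R) : 0 < r -> 0 < Sigma a r t.
Proof. intros Hr. apply sqrt_lt_R0. now apply S2_pos. Qed.

(** Because (r^2 + a^2)^2 - Delta a^2 sin^2 = (r^2 + a^2) Sigma^2 + 2 a^2 r sin^2. *)
Lemma H_eq (a r t : R) : 0 < r -> H a r t = sin t ^ 2 * Hred a r t.
Proof.
  intros Hr. pose proof (S2_pos a r t Hr) as HS.
  unfold H, Hred. rewrite Sigma_sqr. unfold Defs.Delta, S2 in *.
  revert HS. rewrite (cos2_sin2 t). intros HS. field. lra.
Qed.

Lemma is_derive_H (a r t : R) : 0 < r ->
  is_derive (H a r) t (2 * sin t * cos t * Hred a r t * (1 + eta a r t * sin t ^ 2)).
Proof.
  intros Hr. pose proof (S2_pos a r t Hr) as HS. pose proof (Hred_pos a r t Hr) as HH.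
  apply (is_derive_ext (fun z => sin z ^ 2 * Hred a r z)).
  { intros z. now rewrite H_eq. }
  replace (2 * sin t * cos t * Hred a r t * (1 + eta a r t * sin t ^ 2))
    with (2 * sin t * cos t * Hred a r t
      + 2 * sin t * cos t * (2 * a ^ 2 * r * (S2 a r t + a ^ 2 * sin t ^ 2)) / S2 a r t ^ 2 * sin t ^ 2).
  (* The numerator of (sin^2 / Sigma^2)_theta is constant in theta up to the factor 2 sin cos, which
     produces [eta]. *)
  2: { replace (S2 a r t + a ^ 2 * sin t ^ 2) with (r ^ 2 + a ^ 2)
         by (unfold S2; rewrite cos2_sin2; ring).
       unfold eta; field; lra. }
  clear HH. unfold Hred, S2 in *. auto_derive; [lra |].
  simpl in HS |- *. field. lra.
Qed.

Lemma is_derive_Sigma (a r t : R) : 0 < r ->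
  is_derive (Sigma a r) t (- (a ^ 2 * sin t * cos t / S2 a r t) * Sigma a r t).
Proof.
  intros Hr. pose proof (S2_pos a r t Hr) as HS. pose proof (Sigma_pos a r t Hr) as Hp.
  replace (- (a ^ 2 * sin t * cos t / S2 a r t) * Sigma a r t)
    with (- (a ^ 2 * sin t * cos t) / Sigma a r t)
    by (rewrite <- Sigma_sqr; field; lra).
  unfold Sigma, S2 in *. auto_derive; [lra |].
  simpl in Hp |- *. field. lra.
Qed.

Lemma d_theta_H (a r t : R) : 0 < r ->
  d_theta H a r t = 2 * sin t * cos t * Hred a r t * (1 + eta a r t * sin t ^ 2).
Proof. intros Hr. now apply is_derive_unique, is_derive_H. Qed.

Lemma d_theta_Sigma (a r t : R) : 0 < r ->
  d_theta Sigma a r t = - (a ^ 2 * sin t * cos t / S2 a r t) * Sigma a r t.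
Proof. intros Hr. now apply is_derive_unique, is_derive_Sigma. Qed.

(** Delta does not depend on theta, so R and Sigma have the same logarithmic derivative. *)
Lemma d_theta_Rfun (a r t : R) : 0 < r -> 0 < Defs.Delta a r ->
  d_theta Rfun a r t / Rfun a r t = - (a ^ 2 * sin t * cos t / S2 a r t).
Proof.
  intros Hr HD.
  assert (E : forall z, Rfun a r z = / sqrt (Defs.Delta a r) * Sigma a r z).
  { intros z. unfold Rfun. rewrite sqrt_div_alt by exact HD.
    rewrite sqrt_pow2 by (left; now apply Sigma_pos). unfold Rdiv; ring. }
  pose proof (Sigma_pos a r t Hr). pose proof (sqrt_lt_R0 _ HD).
  pose proof (S2_pos a r t Hr).
  unfold d_theta at 1. rewrite (Derive_ext _ _ _ E), Derive_scal, E.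
  rewrite (is_derive_unique _ _ _ (is_derive_Sigma a r t Hr)).
  field. lra.
Qed.

Lemma d_r_Sigma2H (a r t : R) : 0 < r ->
  d_r Sigma2H a r t
  = sin t ^ 2 * (4 * r * (r ^ 2 + a ^ 2) - (2 * r - 2) * a ^ 2 * sin t ^ 2).
Proof.
  intros Hr. unfold d_r. apply is_derive_unique.
  apply (is_derive_ext_loc
    (fun s => sin t ^ 2 * ((s ^ 2 + a ^ 2) ^ 2 - Defs.Delta a s * a ^ 2 * sin t ^ 2))).
  - apply (locally_interval _ r 0 p_infty); simpl; auto.
    intros z Hz _. unfold Sigma2H, H. pose proof (Sigma_pos a z t Hz). field. lra.
  - unfold Defs.Delta. auto_derive; [trivial |]. ring.
Qed.

(* [(Sigma^2 H)_r / (2 H Sigma^2)] *)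
Definition cA (a r t : R) : R :=
  (4 * r * (r ^ 2 + a ^ 2) - (2 * r - 2) * a ^ 2 * sin t ^ 2)
  / (2 * (Hred a r t * S2 a r t)).

(** * The system in terms of the closed forms *)

(** The factor sin^2 cancels between (Sigma^2 H)_r and H, so the coefficient of x is regular; only
    cot remains singular. *)
Lemma y_rhs_eq (a r t x y : R) : 0 < r -> 0 < Defs.Delta a r -> 0 < sin t ->
  y_rhs a r t x y = - (cA a r t * Defs.Delta a r) * x
    + (- (a ^ 2 * sin t * cos t / S2 a r t)
       - cos t / sin t * (1 + eta a r t * sin t ^ 2)) * y.
Proof.
  intros Hr HD Hs. unfold y_rhs.
  pose proof (S2_pos a r t Hr). pose proof (Hred_pos a r t Hr).
  pose proof (Sigma_pos a r t Hr).
  rewrite d_theta_H, d_theta_Sigma, d_r_Sigma2H, H_eq by exact Hr. unfold Rfun. rewrite Sigma_sqr.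
  rewrite pow2_sqrt by (left; now apply Rdiv_lt_0_compat).
  unfold cA. field. lra.
Qed.

(** The coefficient c of the outline. *)
Definition coupling (a r t x y : R) : R :=
  alpha a r t x y * beta a r t y / (2 * H a r t * ell a r t y) - cA a r t.

(** The coefficient g = p y^2 / ell of the outline. The fraction lies in [0, 1], so g and p - g
    inherit the sign of p. *)
Definition damping (a r t y : R) : R :=
  cos t / sin t * (1 + eta a r t * sin t ^ 2) * (y ^ 2 / (y ^ 2 + S2 a r t)).

Lemma continuous_damping (a r t : R) (y : R -> R) : 0 < r -> 0 < sin t ->
  ex_derive y t -> continuous (fun t => damping a r t (y t)) t.
Proof.
  intros Hr Hs Hy.
  pose proof (S2_pos a r t Hr) as HS2. pose proof (Hred_pos a r t Hr) as Hh.
  pose proof (pow2_ge_0 (y t)).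
  apply (ex_derive_continuous (V := R_NormedModule)).
  unfold damping, eta, Hred, S2 in *. auto_derive.
  repeat split; try assumption; simpl in *; try lra.
  apply Rgt_not_eq; repeat apply Rmult_lt_0_compat; lra.
Qed.

Lemma x_rhs_eq (a r t x y : R) : 0 < r -> 0 < Defs.Delta a r -> 0 < sin t ->
  x_rhs a r t x y = - (a ^ 2 * sin t * cos t / S2 a r t) * x
    - coupling a r t x y * y - damping a r t y * x.
Proof.
  intros Hr HD Hs. unfold x_rhs, coupling, damping.
  rewrite d_theta_Rfun by assumption.
  pose proof (S2_pos a r t Hr). pose proof (Hred_pos a r t Hr).
  pose proof (pow2_ge_0 y).
  rewrite d_theta_H, d_r_Sigma2H, H_eq by exact Hr. unfold ell. rewrite Sigma_sqr.
  unfold cA. field. repeat split; try lra.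
Qed.

(** * Parameter range and uniform bounds on the coefficients *)

Record near_regime (a r : R) : Prop := {
  regime_a : 0 <= a ^ 2 <= 1 / 1000;
  regime_r : 199 / 100 < r < 8 / 3;
  regime_Delta : 0 < Defs.Delta a r }.

(** From a < r/100 < 8/300 follows a^2 < 1/1000, hence [r_plus] exceeds 1.99; Delta = (r - 1)^2 - (1
    - a^2) is positive beyond [r_plus]. *)
Lemma near_regime_of_ratio (a r : R) :
  0 <= a <= 1 -> r_plus a < r < 8 / 3 -> a / r < 1 / 100 -> near_regime a r.
Proof.
  intros Ha [Hr1 Hr2] He. unfold r_plus in Hr1.
  assert (Hq : 0 <= 1 - a ^ 2) by nra.
  pose proof (sqrt_pos (1 - a ^ 2)) as Hs0.
  pose proof (pow2_sqrt _ Hq) as Hs.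
  assert (Har : a < r / 100).
  { replace a with (a / r * r) by (field; lra). nra. }
  assert (Ha2 : a ^ 2 <= 1 / 1000) by nra.
  split; [nra | split; [nra | lra] |].
  unfold Defs.Delta. nra.
Qed.

Section Bounds.
Context (a r t : R) (Hreg : near_regime a r).

Lemma sin2_bounds : 0 <= sin t ^ 2 <= 1.
Proof. pose proof (cos2_sin2 t). pose proof (pow2_ge_0 (sin t)).
  pose proof (pow2_ge_0 (cos t)). lra. Qed.

Lemma regime_r_pos : 0 < r.
Proof. destruct Hreg; lra. Qed.

Lemma S2_bounds : r ^ 2 <= S2 a r t <= r ^ 2 + 1 / 1000.
Proof.
  destruct Hreg as [Ha Hr HD]. unfold S2. rewrite cos2_sin2.
  pose proof sin2_bounds. nra.
Qed.

Lemma r2_bounds : 396 / 100 <= r ^ 2 <= 64 / 9.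
Proof. destruct Hreg as [Ha Hr HD]. nra. Qed.

Lemma Hred_bounds : r ^ 2 + a ^ 2 <= Hred a r t <= r ^ 2 + 1 / 100.
Proof.
  pose proof S2_bounds as HS. pose proof sin2_bounds as Hs. pose proof r2_bounds.
  destruct Hreg as [Ha Hr HD]. unfold Hred.
  (* Together with a^2 <= 1/1000 this fills the margin 1/100. *)
  assert (0 <= 2 * a ^ 2 * r * sin t ^ 2 / S2 a r t <= 9 / 1000).
  { assert (0 <= 2 * a ^ 2 * r <= 6 / 1000) by nra.
    split; [apply Rdiv_le_0_compat; nra |].
    apply Rle_div_l; nra. }
  lra.
Qed.

Lemma eta_bounds : 0 <= eta a r t <= 1 / 100.
Proof.
  pose proof S2_bounds as HS. pose proof Hred_bounds. pose proof r2_bounds.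
  destruct Hreg as [Ha Hr HD]. unfold eta.
  assert (0 <= 2 * a ^ 2 * r <= 6 / 1000) by nra.
  assert (15 <= S2 a r t ^ 2) by nra.
  assert (0 <= 2 * a ^ 2 * r * (r ^ 2 + a ^ 2) <= 6 / 1000 * 8) by nra.
  assert (45 <= Hred a r t * S2 a r t ^ 2) by nra.
  split; [apply Rdiv_le_0_compat; lra |].
  apply Rle_div_l; lra.
Qed.

(** The upper bound is the value at a = 0: dropping the sin^2 term only raises the numerator, as r >
    1, and the denominator is at least 2 (r^2 + a^2) r^2. *)
Lemma cA_bounds : 0 < cA a r t <= 2 / r.
Proof.
  pose proof S2_bounds as HS. pose proof Hred_bounds. pose proof r2_bounds.
  pose proof sin2_bounds as Hs.
  destruct Hreg as [Ha Hr HD]. unfold cA.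
  assert (HP : (r ^ 2 + a ^ 2) * r ^ 2 <= Hred a r t * S2 a r t)
    by (apply Rmult_le_compat; lra).
  assert (0 < (r ^ 2 + a ^ 2) * r ^ 2) by (apply Rmult_lt_0_compat; lra).
  assert (Hb : 0 <= (2 * r - 2) * a ^ 2 * sin t ^ 2 <= 1).
  { assert (0 <= (2 * r - 2) * a ^ 2 <= 1) by nra. nra. }
  split.
  - apply Rdiv_lt_0_compat; nra.
  - apply Rle_div_l; [lra |].
    replace (2 / r * (2 * (Hred a r t * S2 a r t)))
      with (4 / r * (Hred a r t * S2 a r t)) by (field; lra).
    apply Rle_trans with (4 / r * ((r ^ 2 + a ^ 2) * r ^ 2)).
    + replace (4 / r * ((r ^ 2 + a ^ 2) * r ^ 2)) with (4 * r * (r ^ 2 + a ^ 2))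
        by (field; lra). lra.
    + apply Rmult_le_compat_l; [| exact HP].
      left; apply Rdiv_lt_0_compat; lra.
Qed.

(** From A <= 2/r, k <= 2 (r - 2) + 2 a^2 / r < 4/3 + 2 a^2 / r, and K = 3/2 leaves room for the
    last term. *)
Lemma k_bounds : 0 < cA a r t * Defs.Delta a r < 3 / 2.
Proof.
  pose proof cA_bounds as HA. destruct Hreg as [Ha Hr HD].
  split; [apply Rmult_lt_0_compat; lra |].
  apply Rle_lt_trans with (2 / r * Defs.Delta a r).
  - apply Rmult_le_compat_r; lra.
  - replace (2 / r * Defs.Delta a r) with (2 * Defs.Delta a r / r) by (field; lra).
    apply Rlt_div_l; [lra |]. unfold Defs.Delta in *. nra.
Qed.

(** * Lower bounds for beta and for the coupling coefficient *)

(** Bounds beta^2 below by H^2 ell / 3, to be paired with alpha^2 >= 3 ell. At a = 0 it amounts to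
    r^2 <= 12, whereas r^2 < 64/9; the slack absorbs the terms in a. *)
Lemma H_theta_sqr_le (y : R) :
  H a r t ^ 2 * ell a r t y / 3
  <= - d_theta H a r t ^ 2 + 4 * H a r t * (y ^ 2 + Sigma a r t ^ 2).
Proof.
  pose proof S2_bounds as HS. pose proof Hred_bounds as Hh. pose proof r2_bounds.
  pose proof sin2_bounds as Hs. pose proof eta_bounds as He.
  pose proof regime_r_pos as Hr0.
  (* The factor sin^2 found here makes 4 H Sigma^2 - H_theta^2 of order sin^4, the same order as
     H^2. *)
  assert (Hid : S2 a r t - cos t ^ 2 * Hred a r t
    = sin t ^ 2 * (r ^ 2 - 2 * a ^ 2 * r * cos t ^ 2 / S2 a r t)).
  { unfold Hred. pose proof (S2_pos a r t Hr0) as Hp.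
    unfold S2 in *. revert Hp. rewrite cos2_sin2. intros Hp. field. lra. }
  assert (Hsm : 2 * a ^ 2 * r * cos t ^ 2 / S2 a r t <= 1 / 100).
  { rewrite cos2_sin2. destruct Hreg as [Ha Hr HD].
    assert (0 <= 2 * a ^ 2 * r <= 6 / 1000) by nra.
    apply Rle_div_l; nra. }
  rewrite d_theta_H, H_eq by exact Hr0. unfold ell. rewrite Sigma_sqr.
  set (w := r ^ 2 - 2 * a ^ 2 * r * cos t ^ 2 / S2 a r t) in *.
  set (S := S2 a r t) in *. set (h := Hred a r t) in *. set (e := eta a r t) in *.
  set (v := sin t ^ 2) in *.
  replace (2 * sin t * cos t * h * (1 + e * v))
    with (2 * (sin t * cos t * (h * (1 + e * v)))) by ring.
  assert (Hc : cos t ^ 2 = 1 - v) by apply cos2_sin2.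
  assert (Hw : r ^ 2 - 1 / 100 <= w) by (unfold w; lra).
  pose proof (pow2_ge_0 a).
  assert (Hcore : 0 <= w - S * h / 12 - (1 - v) * h * (2 * e + e ^ 2 * v)).
  { assert (S * h <= (r ^ 2 + 1 / 1000) * (r ^ 2 + 1 / 100))
      by (apply Rmult_le_compat; lra).
    assert (0 <= 2 * e + e ^ 2 * v <= 3 / 100) by nra.
    assert (0 <= (1 - v) * h <= 8) by nra.
    assert ((1 - v) * h * (2 * e + e ^ 2 * v) <= 8 * (3 / 100))
      by (apply Rmult_le_compat; lra).
    nra. }
  assert (Hv : v * h <= 8) by nra.
  assert (0 <= v * h) by nra.
  pose proof (pow2_ge_0 y).
  assert (Hy : 0 <= v * h * (4 - v * h / 3) * y ^ 2).
  { apply Rmult_le_pos; [apply Rmult_le_pos; lra | assumption]. }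
  assert (Hm : 0 <= 4 * v * h * v * (w - S * h / 12 - (1 - v) * h * (2 * e + e ^ 2 * v))).
  { apply Rmult_le_pos; [| exact Hcore]. nra. }
  (* The difference of the two sides splits into a multiple of y^2 and a part free of y, both
     nonnegative by [Hy] and [Hm]. *)
  assert (E : - (2 * (sin t * cos t * (h * (1 + e * v)))) ^ 2
      + 4 * (v * h) * (y ^ 2 + S) - (v * h) ^ 2 * (y ^ 2 + S) / 3
    = v * h * (4 - v * h / 3) * y ^ 2
      + 4 * v * h * v * (w - S * h / 12 - (1 - v) * h * (2 * e + e ^ 2 * v))).
  { replace ((2 * (sin t * cos t * (h * (1 + e * v)))) ^ 2)
      with (4 * v * (1 - v) * (h * (1 + e * v)) ^ 2)
      by (rewrite <- Hc; unfold v; ring).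
    replace (4 * v * h * v * (w - S * h / 12 - (1 - v) * h * (2 * e + e ^ 2 * v)))
      with (4 * v * h * (v * w - v * (S * h / 12) - v * ((1 - v) * h * (2 * e + e ^ 2 * v))))
      by ring.
    replace (v * w) with (S - (1 - v) * h) by (rewrite <- Hc; exact Hid). field. }
  lra.
Qed.

(** The two lower bounds give alpha beta >= H ell, so c >= 1/2 - A >= 1/2 - 101/100 > -2/3. *)
Lemma coupling_bound (x y : R) : 0 < sin t -> 0 < 1 + 3 / 2 * coupling a r t x y.
Proof.
  intros Hsin.
  pose proof cA_bounds as HA. pose proof S2_bounds as HS. pose proof r2_bounds as Hr2.
  pose proof regime_r_pos as Hr0. pose proof (H_theta_sqr_le y) as Hbeta.
  assert (HHpos : 0 < H a r t).
  { rewrite H_eq by exact Hr0. apply Rmult_lt_0_compat;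
    [now apply pow_lt | now apply Hred_pos]. }
  pose proof (pow2_ge_0 y) as Hy2. pose proof (pow2_ge_0 x) as Hx2.
  assert (Hl : 0 < ell a r t y) by (unfold ell; rewrite Sigma_sqr; lra).
  (* At a = 0, R^2 = r / (r - 2) > 4 for 2 < r < 8/3; the weaker 3 allows for a > 0. *)
  assert (HR : 3 <= Rfun a r t ^ 2).
  { destruct Hreg as [Ha Hr HD]. unfold Rfun. rewrite Sigma_sqr.
    rewrite pow2_sqrt by (apply Rdiv_le_0_compat; lra).
    apply Rle_div_r; [exact HD |]. unfold Defs.Delta. nra. }
  assert (Halpha : 3 * ell a r t y
    <= x ^ 2 * Sigma a r t ^ 2 + Rfun a r t ^ 2 * (y ^ 2 + Sigma a r t ^ 2)).
  { fold (ell a r t y). rewrite Sigma_sqr. nra. }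
  assert (Hab : H a r t * ell a r t y <= alpha a r t x y * beta a r t y).
  { unfold alpha, beta. rewrite <- sqrt_mult_alt by lra.
    rewrite <- (sqrt_pow2 (H a r t * ell a r t y)) by nra.
    apply sqrt_le_1_alt.
    replace ((H a r t * ell a r t y) ^ 2)
      with (3 * ell a r t y * (H a r t ^ 2 * ell a r t y / 3)) by field.
    apply Rmult_le_compat; try lra.
    apply Rmult_le_pos; [| lra]. apply Rmult_le_pos; [apply pow2_ge_0 | lra]. }
  assert (Hhalf : 1 / 2 <= alpha a r t x y * beta a r t y / (2 * H a r t * ell a r t y)).
  { pose proof (Rmult_lt_0_compat _ _ HHpos Hl). apply (Rle_div_r (1 / 2)); lra. }
  assert (Hr2' : 2 / r <= 101 / 100).
  { apply Rle_div_l; [exact Hr0 |]. destruct Hreg; lra. }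
  unfold coupling. lra.
Qed.

End Bounds.

(** * Application to the Kerr system *)

Theorem theorem4p2 :
  exists eps0 : R, 0 < eps0 /\
    forall a r : R, 0 <= a <= 1 -> r_plus a < r < 8 / 3 -> a / r < eps0 ->
      forall x y : R -> R,
        is_solution a r x y ->
        bounded_derivative x -> bounded_derivative y ->
        forall th : R, 0 <= th <= PI -> x th = 0 /\ y th = 0.
Proof.
  exists (1 / 100). split; [lra |].
  intros a r Ha Hr He x y [Cx [Cy Hsol]] Bx By.
  pose proof (near_regime_of_ratio a r Ha Hr He) as Hreg.
  pose proof (regime_r_pos a r Hreg) as Hr0.
  pose proof (regime_Delta a r Hreg) as HD.
  pose proof PI_RGT_0 as Hpi.
  assert (Hsin : forall t, 0 < t < PI -> 0 < sin t)
    by (intros t Ht; apply sin_gt_0; lra).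
  set (p := fun t => cos t / sin t * (1 + eta a r t * sin t ^ 2)).
  set (s := fun t => - (a ^ 2 * sin t * cos t / S2 a r t)).
  set (k := fun t => cA a r t * Defs.Delta a r).
  assert (Hy : forall t, 0 < t < PI ->
    is_derive y t (- k t * x t + (s t - p t) * y t)).
  { intros t Ht. evar_last; [apply (proj1 (Hsol t Ht)) |].
    rewrite y_rhs_eq by auto. unfold k, s, p. ring. }
  assert (Hx : forall t, 0 < t < PI -> is_derive x t
    (s t * x t - coupling a r t (x t) (y t) * y t - damping a r t (y t) * x t)).
  { intros t Ht. evar_last; [apply (proj2 (Hsol t Ht)) |].
    rewrite x_rhs_eq by auto. reflexivity. }
  destruct (bounded_of_bounded_derivative x _ Hx Bx) as [Mx [HMx _]].
  destruct (bounded_of_bounded_derivative y _ Hy By) as [My [HMy HMdy]].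
  (* Vanishing inside suffices; continuity carries it to the end points. *)
  assert (Hzero : forall t, 0 < t < PI -> x t = 0 /\ y t = 0).
  2: { intros t Ht. split; [revert Cx | revert Cy]; intros HC;
       (eapply continuous_on_zero_closure; [exact HC | | exact Ht]);
       intros z Hz; now apply Hzero. }
  assert (Hpcos : forall t, 0 < t < PI -> 0 <= p t * cos t).
  { intros t Ht. specialize (Hsin t Ht).
    replace (p t * cos t)
      with (cos t ^ 2 / sin t * (1 + eta a r t * sin t ^ 2))
      by (unfold p, Rdiv; ring).
    pose proof (eta_bounds a r t Hreg). pose proof (pow2_ge_0 (sin t)).
    apply Rmult_le_pos; [apply Rdiv_le_0_compat; [apply pow2_ge_0 | exact Hsin] | nra]. }
  assert (Hfrac : forall t, 0 <= y t ^ 2 / (y t ^ 2 + S2 a r t) <= 1).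
  { intros t. pose proof (S2_pos a r t Hr0). pose proof (pow2_ge_0 (y t)).
    split; [apply Rdiv_le_0_compat; lra | apply Rle_div_l; lra]. }
  assert (Hsqrt : forall t, 0 < t < PI -> sqrt (H a r t) = sin t * sqrt (Hred a r t)).
  { intros t Ht. rewrite H_eq by exact Hr0.
    rewrite sqrt_mult_alt by apply pow2_ge_0.
    rewrite sqrt_pow2; [reflexivity | left; auto]. }
  assert (Mx0 : 0 <= Mx) by
    (eapply Rle_trans; [apply Rabs_pos | apply (HMx (PI / 2)); lra]).
  assert (My0 : 0 <= My) by
    (eapply Rle_trans; [apply Rabs_pos | apply (HMy (PI / 2)); lra]).
  (* The weight sqrt H / Sigma^2 has logarithmic derivative p - 2 s. The last constant multiplies
     bounds for the weight over sin, for y, and for K x + cot y. *)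
  apply (lyapunov_rigid x y (fun t => sqrt (H a r t) / Sigma a r t ^ 2) k
    (fun t => coupling a r t (x t) (y t)) (fun t => damping a r t (y t)) p s
    (3 / 2) (3 * (My * (3 / 2 * Mx + (My + 3 / 2 * Mx + My))))).
  - intros t Ht. specialize (Hsin t Ht).
    pose proof (is_derive_H a r t Hr0) as dH.
    pose proof (is_derive_Sigma a r t Hr0) as dS.
    pose proof (is_derive_unique _ _ _ dH : Derive (fun z => H a r z) t = _) as EH.
    pose proof (is_derive_unique _ _ _ dS : Derive (fun z => Sigma a r z) t = _) as ES.
    pose proof (Hred_pos a r t Hr0) as Hh. pose proof (Sigma_pos a r t Hr0) as HS.
    pose proof (S2_pos a r t Hr0) as HS2.
    assert (HH : H a r t = sin t ^ 2 * Hred a r t) by now apply H_eq.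
    assert (HHp : 0 < H a r t)
      by (rewrite HH; apply Rmult_lt_0_compat; [now apply pow_lt | exact Hh]).
    evar_last.
    { auto_derive.
      - repeat split; try (eexists; eassumption); try exact HHp.
        apply Rgt_not_eq. simpl. nra.
      - rewrite EH, ES. reflexivity. }
    pose proof (sqrt_lt_R0 _ HHp) as Hq.
    pose proof (pow2_sqrt _ (Rlt_le _ _ HHp)) as Hq2.
    unfold p, s.
    replace (2 * sin t * cos t * Hred a r t * (1 + eta a r t * sin t ^ 2))
      with (2 * (cos t / sin t * (1 + eta a r t * sin t ^ 2)) * sqrt (H a r t) ^ 2)
      by (rewrite Hq2, HH; field; lra).
    field. repeat split; lra.
  - exact Hy.
  - exact Hx.
  - intros t Ht. apply continuous_damping; auto. eexists; now apply Hy.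
  - intros t Ht. specialize (Hfrac t). specialize (Hpcos t Ht).
    replace (damping a r t (y t) * cos t)
      with (p t * cos t * (y t ^ 2 / (y t ^ 2 + S2 a r t)))
      by (unfold p, damping; ring). nra.
  - intros t Ht. specialize (Hfrac t). specialize (Hpcos t Ht).
    replace ((p t - damping a r t (y t)) * cos t)
      with (p t * cos t * (1 - y t ^ 2 / (y t ^ 2 + S2 a r t)))
      by (unfold p, damping; ring). nra.
  - intros t _. now apply k_bounds.
  - intros t Ht. apply coupling_bound; auto.
  - intros t Ht. specialize (Hsin t Ht). rewrite Hsqrt, Sigma_sqr by exact Ht.
    apply Rdiv_lt_0_compat; [| now apply S2_pos].
    apply Rmult_lt_0_compat; [exact Hsin | apply sqrt_lt_R0; now apply Hred_pos].
  - intros t Ht. rewrite Hsqrt, Sigma_sqr by exact Ht.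
    specialize (HMx t Ht). specialize (HMy t Ht). specialize (HMdy t Ht).
    specialize (Hsin t Ht).
    pose proof (S2_bounds a r t Hreg) as HS. pose proof (Hred_bounds a r t Hreg) as Hh.
    pose proof (r2_bounds a r Hreg) as Hr2. pose proof (eta_bounds a r t Hreg) as Heta.
    pose proof (k_bounds a r t Hreg) as Hk. fold (k t) in Hk.
    pose proof (sin2_bounds t) as Hs2.
    assert (Hst : Rabs (s t) <= 1).
    { unfold s. rewrite Rabs_Ropp. unfold Rdiv.
      rewrite !Rabs_mult, (Rabs_pos_eq (/ _)) by (left; apply Rinv_0_lt_compat; lra).
      rewrite (Rabs_pos_eq (a ^ 2)) by apply pow2_ge_0.
      apply Rle_div_l; [lra |].
      assert (Rabs (sin t) <= 1) by (apply Rabs_le, SIN_bound).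
      assert (Rabs (cos t) <= 1) by (apply Rabs_le, COS_bound).
      pose proof (Rabs_pos (sin t)). pose proof (Rabs_pos (cos t)).
      pose proof (regime_a a r Hreg).
      assert (a ^ 2 * Rabs (sin t) <= 1) by nra.
      assert (0 <= a ^ 2 * Rabs (sin t)) by nra. nra. }
    (* The equation for y' is solved for p y = -y' - k x + s y; this is where boundedness of y'
       enters. *)
    assert (Hpy : Rabs (p t * y t) <= My + 3 / 2 * Mx + My).
    { replace (p t * y t)
        with (- (- k t * x t + (s t - p t) * y t) + (- (k t * x t) + s t * y t)) by ring.
      eapply Rle_trans; [apply Rabs_triang |]. rewrite Rabs_Ropp.
      apply Rle_trans with (My + (3 / 2 * Mx + My)); [| lra].
      apply Rplus_le_compat; [exact HMdy |].
      eapply Rle_trans; [apply Rabs_triang |]. rewrite Rabs_Ropp, !Rabs_mult.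
      rewrite (Rabs_pos_eq (k t)) by lra.
      pose proof (Rabs_pos (x t)). pose proof (Rabs_pos (y t)).
      pose proof (Rabs_pos (s t)). nra. }
    assert (Hcy : Rabs (cos t / sin t * y t) <= My + 3 / 2 * Mx + My).
    (* p is cot times 1 + eta sin^2 >= 1, so the bound on p y passes to cot y. *)
    { eapply Rle_trans; [| exact Hpy].
      replace (p t * y t) with ((1 + eta a r t * sin t ^ 2) * (cos t / sin t * y t))
        by (unfold p; ring).
      assert (Hev : 0 <= eta a r t * sin t ^ 2) by nra.
      rewrite (Rabs_mult (1 + _)), (Rabs_pos_eq (1 + _)) by lra.
      pose proof (Rmult_le_pos _ _ Hev (Rabs_pos (cos t / sin t * y t))). lra. }
    assert (Hq : 0 <= sqrt (Hred a r t) <= 3).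
    { split; [apply sqrt_pos |]. rewrite <- (sqrt_pow2 3) by lra.
      apply sqrt_le_1_alt. lra. }
    (* The factor sin t from sqrt H makes f vanish at both ends. *)
    assert (Hrho : 0 <= sin t * sqrt (Hred a r t) / S2 a r t <= 3 * sin t).
    { split; [apply Rdiv_le_0_compat; nra |]. apply Rle_div_l; nra. }
    rewrite !Rabs_mult, (Rabs_pos_eq (_ / S2 a r t)) by apply Hrho.
    assert (Hsum : Rabs (3 / 2 * x t + cos t / sin t * y t)
      <= 3 / 2 * Mx + (My + 3 / 2 * Mx + My)).
    { eapply Rle_trans; [apply Rabs_triang |]. apply Rplus_le_compat; [| exact Hcy].
      rewrite Rabs_mult, Rabs_pos_eq by lra. lra. }
    set (B := 3 / 2 * Mx + (My + 3 / 2 * Mx + My)) in *.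
    replace (3 * (My * B) * sin t) with (3 * sin t * (My * B)) by ring.
    apply Rmult_le_compat; [apply Hrho | | apply Hrho |].
    + apply Rmult_le_pos; apply Rabs_pos.
    + apply Rmult_le_compat; auto using Rabs_pos.
Qed.
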